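(* Let $F$ be a field of characteristic zero and let $\mathcal{T}$ be the free non-symmetric operad over $F$ generated by four binary operations $a,b,c,d$ (concentrated in arity 2), where $a=\searrow$, $b=\nearrow$, $c=\nwarrow$, $d=\swarrow$ are the quadri-algebra operations. Let $S\subset\mathcal{T}(3)$ be the set of the following nine elements, which are the defining identities of quadri-algebras (here $\mu(x,y)$ denotes $x\,\mu\,y$): $$c(c(x,y),z)-c(x,a(y,z))-c(x,b(y,z))-c(x,c(y,z))-c(x,d(y,z)),$$ $$c(d(x,y),z)-d(x,b(y,z))-d(x,c(y,z)),$$ $$d(d(x,y),z)+d(c(x,y),z)-d(x,a(y,z))-d(x,d(y,z)),$$ $$c(b(x,y),z)-b(x,c(y,z))-b(x,d(y,z)),$$ $$c(a(x,y),z)-a(x,c(y,z)),$$ $$d(a(x,y),z)+d(b(x,y),z)-a(x,d(y,z)),$$ $$b(b(x,y),z)+b(c(x,y),z)-b(x,b(y,z))-b(x,a(y,z)),$$ $$b(a(x,y),z)+b(d(x,y),z)-a(x,b(y,z)),$$ $$a(a(x,y),z)+a(b(x,y),z)+a(c(x,y),z)+a(d(x,y),z)-a(x,a(y,z)).$$ Let $(S)$ be the operadic ideal generated by $S$, so that $\mathcal{T}/(S)$ is the non-symmetric quadri-algebra operad. Then $S$ is a self-reduced Gröbner–Shirshov basis for the non-symmetric quadri-algebra operad (i.e. of the ideal $(S)$ of $\mathcal{T}$) with respect to the path-lexicographical ordering of tree monomials induced by the order of operations $c<b<d<a$, and also with respect to the one induced by the order of operations $c<d<b<a$.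
   Context: A quadri-algebra is a vector space with four binary operations $\searrow,\nearrow,\nwarrow,\swarrow$ satisfying $(x\nwarrow y)\nwarrow z=x\nwarrow(y*z)$, $(x\nearrow y)\nwarrow z=x\nearrow(y\prec z)$, $(x\wedge y)\nearrow z=x\nearrow(y\succ z)$, $(x\swarrow y)\nwarrow z=x\swarrow(y\wedge z)$, $(x\searrow y)\nwarrow z=x\searrow(y\nwarrow z)$, $(x\vee y)\nearrow z=x\searrow(y\nearrow z)$, $(x\prec y)\swarrow z=x\swarrow(y\vee z)$, $(x\succ y)\swarrow z=x\searrow(y\swarrow z)$, $(x*y)\searrow z=x\searrow(y\searrow z)$, where $x\succ y=x\nearrow y+x\searrow y$, $x\prec y=x\nwarrow y+x\swarrow y$, $x\vee y=x\searrow y+x\swarrow y$, $x\wedge y=x\nearrow y+x\nwarrow y$, and $x*y=x\searrow y+x\nearrow y+x\nwarrow y+x\swarrow y$. Tree monomials. The free non-symmetric operad $\mathcal{T}$ on a set $X$ of binary operations has as basis of $\mathcal{T}(n)$ the set of planar rooted binary trees with $n$ leaves whose internal vertices are labelled by elements of $X$ (tree monomials); the operadic compositions graft trees at leaves. The monomial $\mu(x,y)$ is the tree with one internal vertex labelled $\mu$; $\mu(\nu(x,y),z)$ is the tree with root $\mu$ whose left child is an internal vertex labelled $\nu$; $\mu(x,\nu(y,z))$ is the tree with root $\mu$ whose right child is labelled $\nu$ (leaves are read from left to right, so variables never change order). An operadic ideal is a family of subspaces closed under composition, on either side, with arbitrary elements of the operad. Path-lexicographical order. Fix a total order on $X$.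 To a tree monomial with $n$ leaves associate the sequence $(w_1,\dots,w_n)$, where $w_i$ is the word in $X$ formed by the labels of the internal vertices met on the path from the root to the $i$-th leaf (leaves ordered from left to right). To compare two tree monomials, first compare the lengths $n$ of their sequences (the longer sequence gives the greater monomial); if equal, compare the sequences word by word from the left, and at the first position where the words differ compare these words degree-lexicographically (longer word is greater; words of equal length are compared lexicographically via the order on $X$); the monomial with the greater word is greater. The leading monomial of a nonzero element is its greatest monomial with nonzero coefficient; the element is monic if that coefficient is 1. Divisibility and reduction. A tree monomial $t$ is divisible by a tree monomial $u$ if $u$ occurs in $t$ as a connected labelled subtree (respecting the left/right planar structure). If $f$ is monic and homogeneous in arity, with leading monomial $u$, and an occurrence of $u$ in $t$ is fixed, let $t[f]$ denote the element obtained from $t$ by replacing this occurrence of $u$ by $f$ (linearly, keeping the rest of $t$ and the trees attached to the leaves of $u$ unchanged); its leading monomial is $t$. A reduction of $g$ with respect to a set $S$ of monic elements replaces $g$ by $g-k\,t[f]$, where $f\in S$ and $t$ is a monomial of $g$ with coefficient $k\neq 0$ divisible by the leading monomial of $f$. Compositions and Gröbner–Shirshov bases. For monic $f,g\in S$ (possibly $f=g$) and a tree monomial $t$ that is the union of an occurrence of the leading monomial of $f$ and an occurrence of the leading monomial of $g$ sharing at least one internal vertex (excluding the case of $f=g$ with identical occurrences), the element $t[f]-t[g]$ is called a composition. The set $S$ is a Gröbner–Shirshov basis (of the ideal $(S)$, or of the operad $\mathcal{T}/(S)$) if every composition of elements of $S$ can be reduced to zero with respect to $S$; by the Composition–Diamond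 Lemma this is equivalent to: the leading monomial of every nonzero element of $(S)$ is divisible by the leading monomial of some element of $S$. It is self-reduced if all its elements are monic and no monomial occurring in an element of $S$ is divisible by the leading monomial of another element of $S$. *)

(* Defs.v *)
From Stdlib Require Export Relation_Operators.
From HB Require Import structures.
From mathcomp Require Export all_boot all_order all_algebra.
From mathcomp Require Export finmap monalg.

Set Implicit Arguments.
Unset Strict Implicit.
Unset Printing Implicit Defensive.

Import GRing.Theory.
Local Open Scope ring_scope.

Inductive tree (X : Type) : Type :=
| Leaf
| Node of X & tree X & tree X.
Arguments Leaf {X}.

Section TreeChoice.
Variable X : Type.

Fixpoint encode_tree (t : tree X) : GenTree.tree X :=
  match t with
  | Leaf => GenTree.Node 0 [::]
  | Node m l r =>
      GenTree.Node 1 [:: GenTree.Leaf m; encode_tree l; encode_tree r]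
  end.

Fixpoint decode_tree (g : GenTree.tree X) : option (tree X) :=
  match g with
  | GenTree.Node 0 [::] => Some Leaf
  | GenTree.Node 1 [:: GenTree.Leaf m; l; r] =>
      if decode_tree l is Some l' then
        if decode_tree r is Some r' then Some (Node m l' r') else None
      else None
  | _ => None
  end.

Lemma encode_treeK : pcancel encode_tree decode_tree.
Proof. by elim=> [|m l IHl r IHr] //=; rewrite IHl IHr. Qed.
End TreeChoice.

HB.instance Definition _ (X : choiceType) :=
  Choice.copy (tree X) (pcan_type (@encode_treeK X)).

Section TreeMonomials.
Variable X : choiceType.
Implicit Types (t u v s : tree X) (p : seq bool) (ltX : rel X).

Fixpoint nleaves t : nat :=
  if t is Node _ l r then nleaves l + nleaves r else 1.

(* Leaves are numbered from 0, so [graft i t u] is t o_(i+1) u in 1-based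
   notation; only i < nleaves t is meaningful. *)
Fixpoint graft (i : nat) t u : tree X :=
  match t with
  | Leaf => u
  | Node m l r =>
      if (i < nleaves l)%N then Node m (graft i l u) r
      else Node m l (graft (i - nleaves l) r u)
  end.

(* [plug v ts] grafts the trees of ts, in order, at all the leaves of v. *)
Fixpoint plug v (ts : seq (tree X)) : tree X :=
  match v with
  | Leaf => nth Leaf ts 0
  | Node m l r =>
      Node m (plug l (take (nleaves l) ts)) (plug r (drop (nleaves l) ts))
  end.

Fixpoint path_words t : seq (seq X) :=
  if t is Node m l r then map (cons m) (path_words l ++ path_words r)
  else [:: [::]].

(* Strict lexicographic comparison of sequences of equal length. *)
Fixpoint lex_lt (T : eqType) (lt : rel T) (s1 s2 : seq T) : bool :=
  match s1, s2 with
  | x :: s1', y :: s2' => lt x y || ((x == y) && lex_lt lt s1' s2')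
  | _, _ => false
  end.

Definition deglex_lt ltX : rel (seq X) := fun w1 w2 =>
  (size w1 < size w2)%N || ((size w1 == size w2) && lex_lt ltX w1 w2).

Definition pathlex_lt ltX : rel (tree X) := fun t u =>
  let wt := path_words t in let wu := path_words u in
  (size wt < size wu)%N
    || ((size wt == size wu) && lex_lt (deglex_lt ltX) wt wu).

(* Vertices are addressed by paths from the root: false goes to the left
   child, true to the right child. *)
Fixpoint vertices t : seq (seq bool) :=
  if t is Node _ l r then
    [::] :: map (cons false) (vertices l) ++ map (cons true) (vertices r)
  else [::].

Fixpoint matches u t : bool :=
  match u, t with
  | Leaf, _ => true
  | Node m l r, Node m' l' r' => [&& m == m', matches l l' & matches r r']
  | _, _ => false
  end.

Fixpoint occurs_at u t p : bool :=
  match p, t with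
  | [::], _ => matches u t
  | b :: p', Node _ l r => occurs_at u (if b then r else l) p'
  | _ :: _, Leaf => false
  end.

Definition divisible t u : Prop := exists p, occurs_at u t p.

Definition occ_vertices u p : seq (seq bool) := map (cat p) (vertices u).

(* The subtrees of t attached to the leaves of an occurrence of u at the root
   of t. *)
Fixpoint attached u t : seq (tree X) :=
  match u, t with
  | Leaf, _ => [:: t]
  | Node _ l r, Node _ l' r' => attached l l' ++ attached r r'
  | _, _ => [::]
  end.

(* Replaces the occurrence of u at p in t by v (of the same arity as u). *)
Fixpoint replace_occ u v t p : tree X :=
  match p, t with
  | [::], _ => plug v (attached u t)
  | b :: p', Node m l r =>
      if b then Node m l (replace_occ u v r p')
      else Node m (replace_occ u v l p') r
  | _ :: _, Leaf => Leaf
  end.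

End TreeMonomials.

Section FreeOperad.
Variables (F : fieldType) (X : choiceType).

(* T is the direct sum of the components T(n) of the free operad; the elements
   of T(n) are those satisfying [in_arity n]. *)
Local Notation T := {malg F[tree X]}.
Implicit Types (f g h : T) (t u v : tree X) (I : nat -> T -> Prop)
  (S : {pred T}) (ltX : rel X).

Definition in_arity (n : nat) f : Prop :=
  forall t, t \in msupp f -> nleaves t = n.

Definition ocomp (i : nat) f g : T :=
  \sum_(t <- msupp f) \sum_(u <- msupp g) << f@_t * g@_u *g graft i t u >>.

Record operadic_ideal I : Prop := OperadicIdeal {
  ideal_arity : forall n f, I n f -> in_arity n f;
  ideal_zero : forall n, I n 0;
  ideal_linear : forall n (k : F) f g, I n f -> I n g -> I n (k *: f + g);
  ideal_comp_left : forall n m i f g, I n f -> in_arity m g -> (i < n)%N ->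
    I (n + m).-1 (ocomp i f g);
  ideal_comp_right : forall n m i f g, I n f -> in_arity m g -> (i < m)%N ->
    I (m + n).-1 (ocomp i g f)
}.

(* The ideal (S) generated by a set S of arity-homogeneous elements. *)
Definition ideal_gen S : nat -> T -> Prop := fun n f =>
  forall I, operadic_ideal I ->
    (forall m g, g \in S -> in_arity m g -> I m g) -> I n f.

Definition leading_monomial ltX f u : Prop :=
  u \in msupp f /\
  forall t, t \in msupp f -> t != u -> pathlex_lt ltX t u.

Definition monic ltX f : Prop :=
  exists2 u, leading_monomial ltX f u & f@_u = 1.

(* t[f], for the occurrence at p in t of the leading monomial u of f. *)
Definition insert_at u p t f : T :=
  \sum_(v <- msupp f) << f@_v *g replace_occ u v t p >>.

Definition reduction ltX S g h : Prop :=
  exists f u t p,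
    [/\ f \in S, leading_monomial ltX f u, t \in msupp g, occurs_at u t p
      & h = g - g@_t *: insert_at u p t f].

Definition reduces_to ltX S : T -> T -> Prop :=
  clos_refl_trans T (reduction ltX S).

(* t is the union of an occurrence of u at p and one of v at q, and these
   share an internal vertex. *)
Definition overlap t u p v q : Prop :=
  [/\ occurs_at u t p, occurs_at v t q,
      vertices t =i occ_vertices u p ++ occ_vertices v q
    & has (mem (occ_vertices u p)) (occ_vertices v q)].

Definition is_composition ltX S h : Prop :=
  exists f g u v t p q,
    [/\ f \in S /\ g \in S,
        leading_monomial ltX f u /\ leading_monomial ltX g v,
        overlap t u p v q,
        ~ (f = g /\ p = q)
      & h = insert_at u p t f - insert_at v q t g].

(* S is a Groebner-Shirshov basis of the ideal I: [gs_generates] says I = (S). *)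
Record gs_basis ltX I S : Prop := GSBasis {
  gs_homogeneous : forall f, f \in S -> exists n, in_arity n f;
  gs_monic : forall f, f \in S -> monic ltX f;
  gs_generates : forall n f, I n f <-> ideal_gen S n f;
  gs_compositions : forall h, is_composition ltX S h -> reduces_to ltX S h 0
}.

Definition self_reduced ltX S : Prop :=
  (forall f, f \in S -> monic ltX f) /\
  (forall f g t u, f \in S -> g \in S -> f <> g -> t \in msupp f ->
     leading_monomial ltX g u -> ~ divisible t u).

End FreeOperad.

Inductive quadop : Type := SE | NE | NW | SW.

Definition nat_of_quadop (m : quadop) : nat :=
  match m with SE => 0 | NE => 1 | NW => 2 | SW => 3 end.
Definition quadop_of_nat (n : nat) : quadop :=
  match n with 0 => SE | 1 => NE | 2 => NW | _ => SW end.
Lemma nat_of_quadopK : cancel nat_of_quadop quadop_of_nat.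
Proof. by case. Qed.

HB.instance Definition _ := Choice.copy quadop (can_type nat_of_quadopK).

(* The strict order listing the elements of s increasingly. *)
Definition lt_of_seq (X : eqType) (s : seq X) : rel X :=
  fun x y => (index x s < index y s)%N.

Section Quadri.
Variable F : fieldType.
Local Notation T := {malg F[tree quadop]}.

Local Notation a := SE.
Local Notation b := NE.
Local Notation c := NW.
Local Notation d := SW.

(* mu(nu(x,y),z) and mu(x,nu(y,z)) *)
Definition lmon (mu nu : quadop) : T :=
  << Node mu (Node nu Leaf Leaf) Leaf >>.
Definition rmon (mu nu : quadop) : T :=
  << Node mu Leaf (Node nu Leaf Leaf) >>.

Definition quadri_S : seq T :=
  [:: lmon c c - rmon c a - rmon c b - rmon c c - rmon c d;
      lmon c d - rmon d b - rmon d c;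
      lmon d d + lmon d c - rmon d a - rmon d d;
      lmon c b - rmon b c - rmon b d;
      lmon c a - rmon a c;
      lmon d a + lmon d b - rmon a d;
      lmon b b + lmon b c - rmon b b - rmon b a;
      lmon b a + lmon b d - rmon a b;
      lmon a a + lmon a b + lmon a c + lmon a d - rmon a a].

Definition op (mu : quadop) : T := << Node mu Leaf Leaf >>.
Definition op_succ : T := op NE + op SE.
Definition op_prec : T := op NW + op SW.
Definition op_vee : T := op SE + op SW.
Definition op_wedge : T := op NE + op NW.
Definition op_star : T := op SE + op NE + op NW + op SW.

(* [assoc_rel m1 m2 m3 m4] stands for (x m1 y) m2 z = x m3 (y m4 z). *)
Definition assoc_rel (m1 m2 m3 m4 : T) : T := ocomp 0 m2 m1 - ocomp 1 m3 m4.

Definition quadri_axioms : seq T :=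
  [:: assoc_rel (op NW) (op NW) (op NW) op_star;
      assoc_rel (op NE) (op NW) (op NE) op_prec;
      assoc_rel op_wedge (op NE) (op NE) op_succ;
      assoc_rel (op SW) (op NW) (op SW) op_wedge;
      assoc_rel (op SE) (op NW) (op SE) (op NW);
      assoc_rel op_vee (op NE) (op SE) (op NE);
      assoc_rel op_prec (op SW) (op SW) op_vee;
      assoc_rel op_succ (op SW) (op SE) (op SW);
      assoc_rel op_star (op SE) (op SE) (op SE)].

(* The ideal presenting the non-symmetric quadri-algebra operad. *)
Definition quadri_ideal : nat -> T -> Prop := ideal_gen [in quadri_axioms].

End Quadri.

Arguments quadri_ideal : clear implicits.

(* Main.v *)
Require Import Defs.

Set Implicit Arguments.
Unset Strict Implicit.
Unset Printing Implicit Defensive.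

Import GRing.Theory.
Local Open Scope ring_scope.

(** All nine relations have integer coefficients and leading coefficient 1,
    and for both orders of the operations their leading monomials are the left
    combs mu(nu(x, y), z) with mu nu one of cc, cd, dd, cb, ca, da, bb, ba, aa,
    where a, b, c, d are SE, NE, NW, SW.  Every left comb beats every
    right comb because the word of its first leaf is longer, and among the left
    combs of one relation only the facts that c is the smallest and a the
    largest operation matter; hence one argument, parametrised by an order for
    which the nine monomials are leading ([leads]), serves both orders.

    Two left combs with two vertices that share a vertex of their union, and
    are not the same occurrence, can only form a left comb with three vertices,
    one of them sitting at the root and the other at its left child
    ([overlap_lcomb2]).  As the nine leading monomials are pairwise distinct,
    coinciding occurrences come from equal relations.  So only the finitely
    many compositions of arity 4 on the left combs mu(nu(rho(x, y), z), w) remain.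

    Each of them is rewritten to zero by a computation.  An element with
    integer coefficients is a list of pairs (coefficient, monomial), evaluated
    in the free operad over F by [eval]; [normalize] rewrites such a list, and
    [reduces_normalize] shows that it performs a legitimate reduction after
    evaluation: a rewriting step at a monomial whose terms cancel leaves the
    evaluated element unchanged, so it is an empty reduction.  The check
    [compositions_ok] that all normal forms are zero thus takes place over the
    integers.

    Finally the axioms of quadri-algebras, once expanded, are the nine
    relations in another order ([quadri_axioms_S]), so both sets generate the
    same ideal. *)

(** * Elements with integer coefficients *)

Section IntegralElements.
Variable X : choiceType.
Implicit Types (t u v : tree X) (p q : seq bool) (s : seq (int * tree X)).

Definition coef t s : int := foldr +%R 0 [seq x.1 | x <- s & x.2 == t].

Definition scale_terms (k : int) s := [seq (k * x.1, x.2) | x <- s].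

Definition insert_terms u p t s :=
  [seq (x.1, replace_occ u x.2 t p) | x <- s].

(** Zero as a sum: the list may still contain terms that cancel. *)
Definition vanishes s := all (fun x => coef x.2 s == 0) s.

Variable F : fieldType.

Definition eval s : {malg F[tree X]} := \sum_(x <- s) << x.1%:~R *g x.2 >>.

Lemma eval_cat s1 s2 : eval (s1 ++ s2) = eval s1 + eval s2.
Proof. exact: big_cat. Qed.

Lemma eval_scale k s : eval (scale_terms k s) = k%:~R *: eval s.
Proof.
rewrite /eval big_map scaler_sumr; apply: eq_bigr => x _ /=.
apply/malgP => t; rewrite [in RHS]mcoeffZ [in RHS]mcoeffU [in LHS]mcoeffU.
by rewrite intrM mulrnAr.
Qed.

Lemma mcoeff_eval s t : (eval s)@_t = (coef t s)%:~R.
Proof.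
rewrite /eval raddf_sum /=; elim: s => [|x s IHs]; first by rewrite big_nil.
rewrite big_cons IHs mcoeffU /coef /=; case: eqP => _ /=.
  by rewrite intrD mulr1n.
by rewrite mulr0n add0r.
Qed.

Lemma coef_notin t s : t \notin [seq x.2 | x <- s] -> coef t s = 0.
Proof.
move=> ts; rewrite /coef; case: (eqVneq [seq x <- s | x.2 == t] [::]) => [->//|].
rewrite -has_filter => /hasP [x xs /eqP xt].
by case/negP: ts; rewrite -xt map_f.
Qed.

Lemma msupp_eval s t : t \in msupp (eval s) -> t \in [seq x.2 | x <- s].
Proof.
apply: contraLR => /coef_notin ts.
by rewrite -mcoeff_eq0 mcoeff_eval ts.
Qed.

(** Gathers all occurrences of t into a single term, which a reduction at t can
    then cancel. *)
Lemma eval_split t s :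
  eval s = eval [seq x <- s | x.2 != t] + (coef t s)%:~R *: eval [:: (1, t)].
Proof.
elim: s => [|x s IHs]; first by rewrite /coef /= scale0r addr0.
rewrite -cat1s eval_cat IHs /coef /=; case: eqVneq => [<-|_] /=.
  have -> : eval [:: x] = x.1%:~R *: eval [:: (1, x.2)].
    by rewrite -eval_scale /scale_terms /= mulr1 -surjective_pairing.
  by rewrite addrCA intrD scalerDl.
by rewrite addrA -eval_cat.
Qed.

Lemma eval_vanishes s : vanishes s -> eval s = 0.
Proof.
move=> /allP s0; apply/malgP => t; rewrite mcoeff_eval mcoeff0.
have [/mapP [x xs ->]|/coef_notin -> //] := boolP (t \in [seq x.2 | x <- s]).
by rewrite (eqP (s0 _ xs)).
Qed.

Lemma eval_eq s1 s2 : vanishes (s1 ++ scale_terms (-1) s2) -> eval s1 = eval s2.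
Proof.
move=> /eval_vanishes; rewrite eval_cat eval_scale mulrN1z scaleN1r.
exact: subr0_eq.
Qed.

(** Sums over the support extended additively in the coefficient depend only on
    the element, so they may be computed on any list that represents it, even
    one with repeated monomials.  Both substitution and operadic composition
    are defined by such sums. *)
Lemma big_msupp_eval (V : zmodType) (h : tree X -> F -> V) s :
    (forall t, {morph h t : x y / x + y}) ->
  \sum_(t <- msupp (eval s)) h t (eval s)@_t = \sum_(x <- s) h x.2 x.1%:~R.
Proof.
move=> hD; have h0 t : h t 0 = 0 by apply: (addrI (h t 0)); rewrite -hD !addr0.
pose r := undup [seq x.2 | x <- s].
have -> : \sum_(t <- msupp (eval s)) h t (eval s)@_t
        = \sum_(t <- r) h t (eval s)@_t.
  rewrite [RHS](bigID (mem (msupp (eval s)))) /= [X in _ + X]big1 ?addr0.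
    rewrite -[RHS]big_filter; apply: perm_big; apply: uniq_perm.
    - exact: fset_uniq.
    - by rewrite filter_uniq ?undup_uniq.
    move=> t; rewrite mem_filter /r mem_undup.
    by apply/idP/andP => [ts|[]//]; split=> //; apply: msupp_eval.
  by move=> t /mcoeff_outdom ->.
have {}h_sum t : h t (eval s)@_t = \sum_(x <- s) h t (x.1%:~R *+ (x.2 == t)).
  rewrite /eval raddf_sum (big_morph (h t) (hD t) (h0 t)).
  by apply: eq_bigr => x _ /=; rewrite mcoeffU.
rewrite (eq_bigr _ (fun t _ => h_sum t)) exchange_big /=.
rewrite big_seq [RHS]big_seq; apply: eq_bigr => x xs.
rewrite (bigD1_seq x.2) ?undup_uniq ?mem_undup ?map_f //= eqxx mulr1n.
rewrite big1 ?addr0 // => t; rewrite eq_sym => /negbTE ->.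
by rewrite mulr0n h0.
Qed.

Lemma insert_at_eval u p t s :
  insert_at u p t (eval s) = eval (insert_terms u p t s).
Proof.
rewrite /insert_at [RHS]big_map.
apply: (@big_msupp_eval _ (fun v k => << k *g replace_occ u v t p >>)) => v x y.
exact: monalgUD.
Qed.

Lemma ocomp_eval i s1 s2 :
  ocomp i (eval s1) (eval s2)
  = eval [seq (x.1 * y.1, graft i x.2 y.2) | x <- s1, y <- s2].
Proof.
rewrite /ocomp [RHS]big_allpairs_dep /=.
rewrite (@big_msupp_eval _ (fun t k => \sum_(u <- msupp (eval s2))
           << k * (eval s2)@_u *g graft i t u >>)) => [|t x y].
  apply: eq_bigr => x _.
  rewrite (@big_msupp_eval _ (fun u k => << x.1%:~R * k *g graft i x.2 u >>)).
    by apply: eq_bigr => y _; rewrite intrM.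
  by move=> u y z; rewrite mulrDr monalgUD.
by rewrite -big_split; apply: eq_bigr => u _; rewrite mulrDl monalgUD.
Qed.

End IntegralElements.

(** * Replacing an occurrence of a monomial *)

Section Occurrences.
Variable X : choiceType.
Implicit Types (t u : tree X) (p : seq bool).

Lemma size_attached u t : matches u t -> size (attached u t) = nleaves u.
Proof.
elim: u t => [|m l IHl r IHr] [|m' l' r'] //= /and3P [_ ml mr].
by rewrite size_cat IHl ?IHr.
Qed.

Lemma plug_attached u t : matches u t -> plug u (attached u t) = t.
Proof.
elim: u t => [|m l IHl r IHr] [|m' l' r'] //= /and3P [/eqP <- ml mr].
rewrite -(size_attached ml) take_size_cat // drop_size_cat //.
by rewrite IHl ?IHr.
Qed.

Lemma replace_occ_id u t p : occurs_at u t p -> replace_occ u u t p = t.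
Proof.
elim: p t => [|b p IHp] [|m l r] //; try exact: plug_attached.
by case: b => /= /IHp ->.
Qed.

End Occurrences.

(** * Reductions computed on integer coefficients *)

Section IntegralReduction.
Variables (X : choiceType) (F : fieldType) (ltX : rel X).
Implicit Types (t u v : tree X) (p q : seq bool) (s : seq (int * tree X)).

(** A pair (u, s) encodes the monic element u + s. *)
Definition rule : Type := tree X * seq (int * tree X).
Implicit Types (r : rule) (rs : seq rule).

Definition rule_terms r : seq (int * tree X) := (1, r.1) :: r.2.

(** The converse comparison is excluded explicitly, which makes the leading
    monomial unique without any hypothesis on ltX. *)
Definition leads r : bool :=
  all (fun x => pathlex_lt ltX x.2 r.1 && ~~ pathlex_lt ltX r.1 x.2) r.2.

Local Notation evalF := (@eval X F).
Local Notation relator r := (evalF (rule_terms r)).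

Lemma mcoeff_lead r : leads r -> (relator r)@_r.1 = 1.
Proof.
move=> /allP lr; rewrite mcoeff_eval /coef /= eqxx /=.
rewrite -/(coef r.1 r.2) coef_notin ?addr0 //.
by apply/mapP => -[x /lr /andP [+ +] x_eq]; rewrite -x_eq => ->.
Qed.

Lemma leading_monomial_rule r : leads r -> leading_monomial ltX (relator r) r.1.
Proof.
move=> lr; split=> [|t /msupp_eval].
  by rewrite -mcoeff_neq0 mcoeff_lead ?oner_eq0.
rewrite inE => /predU1P [->|/mapP [x xr ->] _]; first by rewrite eqxx.
by have /andP [] := allP lr x xr.
Qed.

Lemma leading_monomial_inj r u :
  leads r -> leading_monomial ltX (relator r) u -> u = r.1.
Proof.
move=> lr [/msupp_eval ur u_max].
move: ur; rewrite inE => /predU1P [//|/mapP [x xr u_eq]].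
have [r_supp _] := leading_monomial_rule lr.
apply: contraTeq (allP lr x xr) => /=; rewrite -u_eq eq_sym.
by move=> /(u_max _ r_supp) ->; rewrite andbF.
Qed.

(** Since t[u] = t, subtracting the multiple of t[u + s'] removes t altogether
    and only the tail s' of the rule has to be inserted. *)
Definition reduce_at r t p s :=
  [seq x <- s | x.2 != t]
    ++ scale_terms (- coef t s) (insert_terms r.1 p t r.2).

Definition redexes rs t : seq (rule * seq bool) :=
  [seq rp <- [seq (r, p) | r <- rs, p <- vertices t] | occurs_at rp.1.1 t rp.2].

Fixpoint find_redex rs s : option (tree X * (rule * seq bool)) :=
  if s is x :: s' then
    if redexes rs x.2 is rp :: _ then Some (x.2, rp) else find_redex rs s'
  else None.

(** The number n of steps bounds the rewriting, whose termination need not be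
    established: any sequence of reductions that ends in zero will do. *)
Fixpoint normalize rs n s :=
  match n, find_redex rs s with
  | n'.+1, Some (t, (r, p)) => normalize rs n' (reduce_at r t p s)
  | _, _ => s
  end.

(** A reduction must act on a monomial of the support.  If t is not one, because
    its terms in the list cancel, the step changes nothing and is the empty
    reduction; so no coefficient has to be shown nonzero. *)
Lemma reduces_reduce_at (S : {pred {malg F[tree X]}}) r t p s :
    relator r \in S -> leads r -> occurs_at r.1 t p ->
  reduces_to ltX S (evalF s) (evalF (reduce_at r t p s)).
Proof.
move=> rS lr occ.
have -> : evalF (reduce_at r t p s)
          = evalF s - (evalF s)@_t *: insert_at r.1 p t (relator r).
  rewrite insert_at_eval mcoeff_eval /= /insert_terms /= replace_occ_id //.
  rewrite -/(insert_terms _ _ _ _) -cat1s eval_cat scalerDr opprD addrA.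
  rewrite (eval_split F t s) addrK.
  by rewrite eval_cat eval_scale mulrNz scaleNr.
have [ts|/mcoeff_outdom ->] := boolP (t \in msupp (evalF s)).
  apply: rt_step; exists (relator r), r.1, t, p; split=> //.
  exact: leading_monomial_rule.
by rewrite scale0r subr0; apply: rt_refl.
Qed.

Lemma find_redexP rs s t r p :
  find_redex rs s = Some (t, (r, p)) -> r \in rs /\ occurs_at r.1 t p.
Proof.
elim: s => //= x s IHs; case red_x: (redexes rs x.2) => [|rp l] // [<- rp_eq].
have : (r, p) \in redexes rs x.2 by rewrite red_x rp_eq mem_head.
rewrite mem_filter => /andP [occ /allpairsPdep [r' [q [r'rs _ [r_eq _]]]]].
by rewrite r_eq in occ *.
Qed.

Lemma reduces_normalize (S : {pred {malg F[tree X]}}) rs n s :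
    {in rs, forall r, relator r \in S} -> {in rs, forall r, leads r} ->
  reduces_to ltX S (evalF s) (evalF (normalize rs n s)).
Proof.
move=> rsS rsl; elim: n s => [|n IHn] s /=; first exact: rt_refl.
case red_s: (find_redex rs s) => [[t [r p]]|]; last exact: rt_refl.
have [r_rs occ] := find_redexP red_s.
by apply: rt_trans (IHn _); apply: reduces_reduce_at; auto.
Qed.

End IntegralReduction.

(** * Overlaps of left combs *)

Section Overlaps.
Variable X : choiceType.
Implicit Types (t u v : tree X) (m n : X) (p q : seq bool).

Definition lcomb2 m n : tree X := Node m (Node n Leaf Leaf) Leaf.
Definition lcomb3 m n k : tree X := Node m (lcomb2 n k) Leaf.

(** A structural form of membership in [vertices], which decides on a partly
    known tree whether a given address is a leaf. *)
Fixpoint inner_at t p : bool :=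
  match t, p with
  | Leaf, _ => false
  | Node _ _ _, [::] => true
  | Node _ l r, b :: p' => inner_at (if b then r else l) p'
  end.

Lemma mem_vertices t p : (p \in vertices t) = inner_at t p.
Proof.
elim: t p => [|m l IHl r IHr] //= [|b p] //; rewrite inE mem_cat /=.
have mapE (c : bool) vs : (b :: p \in map (cons c) vs) = (b == c) && (p \in vs).
  case: eqVneq => [->|bc]; first by rewrite mem_map // => ? ? [].
  by apply/mapP => -[q _ [bc']]; rewrite bc' eqxx in bc.
by rewrite !mapE IHl IHr; case: b {mapE}; rewrite ?orbF.
Qed.

Lemma occurs_at_vertices u t p : u != Leaf -> occurs_at u t p -> p \in vertices t.
Proof.
rewrite mem_vertices; case: u => // m' l' r' _.
by elim: p t => [|b p IHp] [|m l r] //=; apply: IHp.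
Qed.

Lemma occurs_at_lcomb2 m n m' n' t p :
  occurs_at (lcomb2 m n) t p -> occurs_at (lcomb2 m' n') t p ->
  lcomb2 m n = lcomb2 m' n'.
Proof.
elim: p t => [|b p IHp] [|k l r] //=; last exact: IHp.
case: l => [|k' l l']; rewrite ?andbF //=.
rewrite !andbT => /andP [/eqP -> /eqP ->] /andP [/eqP -> /eqP ->] //.
Qed.

(** The vertices of the first occurrence are the root and its left child, so a
    second occurrence that meets it elsewhere than at the root starts at this
    child; the union has no other vertex, which forces all side branches to be
    leaves. *)
Lemma overlap_lcomb2_root t m n m' n' q :
    overlap t (lcomb2 m n) [::] (lcomb2 m' n') q -> q != [::] ->
  q = [:: false] /\ exists k, t = lcomb3 m n k.
Proof.
move=> [occ_u occ_v t_vert] /hasP [w w_v w_u] q0.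
have {w w_v w_u} q_eq : q = [:: false].
  (* w is the root or the left child of both occurrences *)
  move: w_v w_u; rewrite /= !inE.
  by case: q q0 {occ_v t_vert} => [|[] [|? ?]] //= _ /orP [] /eqP ->.
split=> //; subst q; have t_in w := esym (mem_vertices t w).
(* the addresses of the four side branches, none of which is a vertex *)
move: occ_u occ_v (t_in [:: true]) (t_in [:: false; true])
  (t_in [:: false; false; false]) (t_in [:: false; false; true]).
rewrite !t_vert {t_vert t_in}.
case: t => [|k1 [|k2 l2 r2] r1]; rewrite /= ?andbF //.
rewrite !andbT => /andP [/eqP <- /eqP <-]; case: l2 => [|k3 l3 r3].
  by rewrite andbF.
by case: r1 r2 l3 r3 => [|? ? ?] [|? ? ?] [|? ? ?] [|? ? ?] //; exists k3.
Qed.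

Lemma overlap_sym t u p v q : overlap t u p v q -> overlap t v q u p.
Proof.
move=> [occ_u occ_v t_vert meet]; split=> //; last by rewrite has_sym.
by move=> w; rewrite t_vert !mem_cat orbC.
Qed.

(** The root of t is a vertex of the union, hence the root of one of the two
    occurrences; by symmetry the previous case applies. *)
Lemma overlap_lcomb2 t m n p m' n' q :
    overlap t (lcomb2 m n) p (lcomb2 m' n') q -> p != q ->
  [/\ (p, q) \in [:: ([::], [:: false]); ([:: false], [::])]
    & exists k1 k2 k3, t = lcomb3 k1 k2 k3].
Proof.
move=> ov pq; have [occ_u _ t_vert _] := ov.
have : [::] \in vertices t.
  by rewrite mem_vertices; case: t p occ_u {ov t_vert pq} => [|? ? ?] [].
rewrite t_vert mem_cat /= !inE.
case: p ov pq {occ_u t_vert} => [|c p] ov pq.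
  have [-> [k ->]] := overlap_lcomb2_root ov (contra_neq (@esym _ _ _) pq).
  by split=> //; exists m, n, k.
case: q ov pq => // ov pq _.
have [-> [k ->]] := overlap_lcomb2_root (overlap_sym ov) isT.
by split=> //; exists m', n', k.
Qed.

End Overlaps.

(** * The quadri-algebra relations *)

Section Quadri.

Definition rcomb2 (m n : quadop) : tree quadop := Node m Leaf (Node n Leaf Leaf).

Definition quadri_rules : seq (rule quadop) :=
  [:: (lcomb2 NW NW, [:: (-1, rcomb2 NW SE); (-1, rcomb2 NW NE);
                         (-1, rcomb2 NW NW); (-1, rcomb2 NW SW)]);
      (lcomb2 NW SW, [:: (-1, rcomb2 SW NE); (-1, rcomb2 SW NW)]);
      (lcomb2 SW SW, [:: (1, lcomb2 SW NW); (-1, rcomb2 SW SE);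
                         (-1, rcomb2 SW SW)]);
      (lcomb2 NW NE, [:: (-1, rcomb2 NE NW); (-1, rcomb2 NE SW)]);
      (lcomb2 NW SE, [:: (-1, rcomb2 SE NW)]);
      (lcomb2 SW SE, [:: (1, lcomb2 SW NE); (-1, rcomb2 SE SW)]);
      (lcomb2 NE NE, [:: (1, lcomb2 NE NW); (-1, rcomb2 NE NE);
                         (-1, rcomb2 NE SE)]);
      (lcomb2 NE SE, [:: (1, lcomb2 NE SW); (-1, rcomb2 SE NE)]);
      (lcomb2 SE SE, [:: (1, lcomb2 SE NE); (1, lcomb2 SE NW);
                         (1, lcomb2 SE SW); (-1, rcomb2 SE SE)])].

Definition composition_terms (r1 r2 : rule quadop) t p q :=
  insert_terms r1.1 p t (rule_terms r1)
    ++ scale_terms (-1) (insert_terms r2.1 q t (rule_terms r2)).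

Definition quadops := [:: SE; NE; NW; SW].

Definition lcombs3 : seq (tree quadop) :=
  [seq Node m t Leaf | m <- quadops,
     t <- [seq lcomb2 n k | n <- quadops, k <- quadops]].

(** The conditional makes call-by-value evaluation normalize only the
    compositions that exist; 50 steps suffice for each of them. *)
Definition composition_ok r1 r2 t p q :=
  if occurs_at r1.1 t p && occurs_at r2.1 t q
  then vanishes (normalize quadri_rules 50 (composition_terms r1 r2 t p q))
  else true.

(** The confluence computation: every composition of two relations has normal
    form zero.  Both orders of the two relations are normalized, as a
    composition may subtract either side from the other. *)
Lemma compositions_ok : all (fun r1 => all (fun r2 => all (fun t =>
    composition_ok r1 r2 t [::] [:: false] &&
    composition_ok r1 r2 t [:: false] [::]) lcombs3) quadri_rules) quadri_rules.
Proof. by vm_compute. Qed.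

Lemma lcombs3P m n k : lcomb3 m n k \in lcombs3.
Proof. by case: m; case: n; case: k. Qed.

Lemma quadri_rules_lead r : r \in quadri_rules -> exists m n, r.1 = lcomb2 m n.
Proof.
have /allP : all (fun r => r.1 \in [seq lcomb2 m n | m <- quadops, n <- quadops])
                 quadri_rules by vm_compute.
by move=> H /H /allpairsPdep [m [n [_ _ ->]]]; exists m, n.
Qed.

Lemma quadri_rules_lead_inj : {in quadri_rules &, injective fst}.
Proof.
move=> r1 r2 r1in r2in /eqP r12; apply/eqP; move: r12; apply/implyP.
have /allP H : all (fun r1 : rule quadop => all (fun r2 : rule quadop =>
  (r1.1 == r2.1) ==> (r1 == r2)) quadri_rules) quadri_rules by vm_compute.
exact: (allP (H r1 r1in)).
Qed.

Lemma quadri_rules_reduced r1 r2 t p :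
    r1 \in quadri_rules -> r2 \in quadri_rules -> r1 != r2 ->
    t \in [seq x.2 | x <- rule_terms r1] ->
  ~~ occurs_at r2.1 t p.
Proof.
move=> r1in r2in r12 tr.
have /allP H : all (fun r1 : rule quadop => all (fun r2 : rule quadop =>
  (r1 != r2) ==> all (fun t => ~~ has (occurs_at r2.1 t) (vertices t))
    [seq x.2 | x <- rule_terms r1]) quadri_rules) quadri_rules by vm_compute.
have /implyP /(_ r12) /allP /(_ t tr) := allP (H r1 r1in) r2 r2in.
apply: contraNN => occ; apply/hasP; exists p => //.
by apply: occurs_at_vertices occ; have [m [n ->]] := quadri_rules_lead r2in.
Qed.

Variable F : fieldType.
Local Notation evalF := (@eval quadop F).
Local Notation relator r := (evalF (rule_terms r)).

(** The next lemmas turn an expression in the free operad, by following its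
    syntax, into the evaluation of a list, so that equations between such
    expressions are decided by computing with lists. *)
Lemma eval_add f1 f2 s1 s2 :
  f1 = evalF s1 -> f2 = evalF s2 -> f1 + f2 = evalF (s1 ++ s2).
Proof. by move=> -> ->; rewrite eval_cat. Qed.

Lemma eval_opp f s : f = evalF s -> - f = evalF (scale_terms (-1) s).
Proof. by move=> ->; rewrite eval_scale mulrN1z scaleN1r. Qed.

Lemma eval_mono t : << t >> = evalF [:: (1, t)].
Proof. by rewrite /eval big_cons big_nil addr0. Qed.

Lemma eval_ocomp i f1 f2 s1 s2 : f1 = evalF s1 -> f2 = evalF s2 ->
  ocomp i f1 f2
  = evalF [seq (x.1 * y.1, graft i x.2 y.2) | x <- s1, y <- s2].
Proof. by move=> -> ->; rewrite ocomp_eval. Qed.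

Ltac eval_expr :=
  lazymatch goal with
  | |- _ + _ = _ => apply: eval_add; eval_expr
  | |- - _ = _ => apply: eval_opp; eval_expr
  | |- ocomp _ _ _ = _ => apply: eval_ocomp; eval_expr
  | |- _ => exact: eval_mono
  end.

Lemma quadri_SE : quadri_S F = [seq relator r | r <- quadri_rules].
Proof.
rewrite /quadri_S [RHS]/=.
do 9![apply: (f_equal2 cons);
  first by apply: etrans; [eval_expr|apply: (congr1 evalF)]].
by [].
Qed.

Lemma mem_quadri_S f :
  reflect (exists2 r, r \in quadri_rules & f = relator r) (f \in quadri_S F).
Proof. by rewrite quadri_SE; apply: mapP. Qed.

(** The i-th entry is the relation to which the i-th axiom expands, up to the
    order of its terms. *)
Definition quadri_rules_by_axiom : seq (rule quadop) :=
  [seq nth (Leaf, [::]) quadri_rules i | i <- [:: 0; 3; 6; 1; 4; 7; 2; 5; 8]%N].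

Lemma quadri_axiomsE :
  quadri_axioms F = [seq relator r | r <- quadri_rules_by_axiom].
Proof.
rewrite /quadri_axioms /assoc_rel /op_succ /op_prec /op_vee /op_wedge /op_star.
rewrite [RHS]/=.
do 9![apply: (f_equal2 cons);
  first by apply: etrans; [eval_expr|apply: eval_eq; vm_compute]].
by [].
Qed.

Lemma quadri_axioms_S : quadri_axioms F =i quadri_S F.
Proof.
rewrite quadri_axiomsE quadri_SE; apply/perm_mem/perm_map.
by vm_compute.
Qed.

Lemma eq_ideal_gen (X : choiceType) (S1 S2 : seq {malg F[tree X]}) n f :
  S1 =i S2 -> ideal_gen [in S1] n f <-> ideal_gen [in S2] n f.
Proof.
move=> S12; split=> If I idI genI; apply: If => // m g gS; apply: genI.
  by move: gS; rewrite /= S12.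
by move: gS; rewrite /= -S12.
Qed.

(** * Compositions and the Groebner-Shirshov property *)

Variable ltX : rel quadop.
Hypothesis quadri_leads : all (leads ltX) quadri_rules.

Lemma quadri_leading r u :
    r \in quadri_rules -> leading_monomial ltX (relator r) u -> u = r.1.
Proof. by move=> r_in; apply: leading_monomial_inj; apply: (allP quadri_leads). Qed.

(** Coinciding occurrences would give equal leading monomials, hence equal
    relations; all other overlaps are left combs with three vertices, whose
    compositions have been normalized to zero. *)
Lemma quadri_composition h :
  is_composition ltX [in quadri_S F] h -> reduces_to ltX [in quadri_S F] h 0.
Proof.
move=> [f [g [u [v [t [p [q [[]]]]]]]]].
move=> /mem_quadri_S [r1 r1in ->] /mem_quadri_S [r2 r2in ->].
move=> [/(quadri_leading r1in) -> /(quadri_leading r2in) ->] ov fg ->.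
have [occ1 occ2 _ _] := ov.
have [m1 [n1 lead1]] := quadri_rules_lead r1in.
have [m2 [n2 lead2]] := quadri_rules_lead r2in.
have pq : p != q.
  apply/eqP => pq; apply: fg; split=> //; congr (relator _).
  apply: quadri_rules_lead_inj => //; rewrite lead1 lead2.
  by apply: (@occurs_at_lcomb2 _ _ _ _ _ t p); rewrite -?lead1 // pq -lead2.
rewrite !insert_at_eval.
have -> : evalF (insert_terms r1.1 p t (rule_terms r1))
            - evalF (insert_terms r2.1 q t (rule_terms r2))
          = evalF (composition_terms r1 r2 t p q).
  exact: eval_add (erefl _) (eval_opp (erefl _)).
have ok : composition_ok r1 r2 t p q.
  rewrite lead1 lead2 in ov.
  have [pq_in [k1 [k2 [k3 t_eq]]]] := overlap_lcomb2 ov pq.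
  have /andP [ok1 ok2] := allP (allP (allP compositions_ok r1 r1in) r2 r2in)
    t (eq_ind_r (fun t => t \in lcombs3) (lcombs3P k1 k2 k3) t_eq).
  move: pq_in; rewrite !inE => /orP [] /eqP [-> ->]; [exact: ok1|exact: ok2].
move: ok; rewrite /composition_ok occ1 occ2 andbT => /(eval_vanishes F) <-.
apply: reduces_normalize => r r_in; last exact: (allP quadri_leads).
by apply/mem_quadri_S; exists r.
Qed.

Lemma quadri_monic f : f \in quadri_S F -> monic ltX f.
Proof.
move=> /mem_quadri_S [r /(allP quadri_leads) lr ->]; exists r.1.
  exact: leading_monomial_rule.
exact: mcoeff_lead lr.
Qed.

Lemma quadri_arity f : f \in quadri_S F -> in_arity 3 f.
Proof.
move=> /mem_quadri_S [r r_in ->] t /msupp_eval /mapP [x xr ->].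
have /allP H : all (fun r => all (fun x : int * tree quadop => nleaves x.2 == 3)
  (rule_terms r)) quadri_rules by vm_compute.
exact/eqP/(allP (H r r_in)).
Qed.

Lemma quadri_gs_basis : gs_basis ltX (quadri_ideal F) [in quadri_S F].
Proof.
split=> [f fS|f|n f|h]; first by exists 3; apply: quadri_arity.
- exact: quadri_monic.
- exact: eq_ideal_gen quadri_axioms_S.
exact: quadri_composition.
Qed.

Lemma quadri_self_reduced : self_reduced ltX [in quadri_S F].
Proof.
split=> [|f g t u /mem_quadri_S [r1 r1in ->] /mem_quadri_S [r2 r2in ->] fg].
  exact: quadri_monic.
move=> /msupp_eval tr /(quadri_leading r2in) -> [p]; apply/negP.
apply: quadri_rules_reduced tr => //.
by apply: contra_not_neq fg => ->.
Qed.

End Quadri.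

Theorem theorem3 (F : fieldType) (charF : [pchar F]%R =i pred0) :
  (gs_basis (lt_of_seq [:: NW; NE; SW; SE]) (quadri_ideal F) [in quadri_S F] /\
   self_reduced (lt_of_seq [:: NW; NE; SW; SE]) [in quadri_S F]) /\
  (gs_basis (lt_of_seq [:: NW; SW; NE; SE]) (quadri_ideal F) [in quadri_S F] /\
   self_reduced (lt_of_seq [:: NW; SW; NE; SE]) [in quadri_S F]).
Proof.
have leads1 : all (leads (lt_of_seq [:: NW; NE; SW; SE])) quadri_rules.
  by vm_compute.
have leads2 : all (leads (lt_of_seq [:: NW; SW; NE; SE])) quadri_rules.
  by vm_compute.
by do 2![split]; [apply: quadri_gs_basis|apply: quadri_self_reduced
                 |apply: quadri_gs_basis|apply: quadri_self_reduced].
Qed.
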